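(* If $(\mathscr{A},\|\cdot\|)$ is a unital (nonzero) $C^*$-algebra and its norm $\|\cdot\|$ is strictly convex and is a $3$-positive map $\mathscr{A}\to\mathbb{C}$, then $\mathscr{A}=\mathbb{C}$ (that is, $\mathscr{A}=\mathbb{C}I$).
   Context: A norm $\|\cdot\|$ on a normed space $\mathcal{X}$ is called strictly convex if for all non-zero $X,Y\in\mathcal{X}$, $\|X+Y\|=\|X\|+\|Y\|$ implies $X=\lambda Y$ for some $\lambda\in\mathbb{C}$. A (not necessarily linear) map $\Phi:\mathscr{A}\to\mathscr{B}$ between $C^*$-algebras is $n$-positive if the entrywise map $\Phi_n:M_n(\mathscr{A})\to M_n(\mathscr{B})$, $\Phi_n([a_{ij}])=[\Phi(a_{ij})]$, sends positive elements to positive elements. Here $\mathscr{B}=\mathbb{C}$, so $3$-positivity of $\|\cdot\|$ means that $[\|a_{ij}\|]\in M_3(\mathbb{C})$ is positive semidefinite whenever $[a_{ij}]\in M_3(\mathscr{A})$ is positive. *)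

(* Defs.v *)
From HB Require Import structures.
From mathcomp Require Import all_boot all_order all_algebra.
From mathcomp Require Import complex reals.

Set Implicit Arguments.
Unset Strict Implicit.
Unset Printing Implicit Defensive.

Import Order.TTheory GRing.Theory Num.Theory.

Local Open Scope ring_scope.
Local Open Scope complex_scope.

(* The norm is a field of this mixin, and completeness is written out with
   Cauchy sequences, because the hierarchy has no structure that is both a
   normed R[i]-module and a ring without being a numDomainType. *)
HB.mixin Record Algebra_isCStarAlgebra (R : realType) A
    of GRing.Algebra R[i] A := {
  cnorm : A -> R;
  cnorm0_eq0 : forall a : A, cnorm a = 0 -> a = 0;
  ler_cnormD : forall a b : A, cnorm (a + b) <= cnorm a + cnorm b;
  cnormZ : forall (z : R[i]) (a : A), cnorm (z *: a) = Normc.normc z * cnorm a;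
  ler_cnormM : forall a b : A, cnorm (a * b) <= cnorm a * cnorm b;
  cnorm_complete : forall u : nat -> A,
    (forall e : R, 0 < e -> exists N : nat, forall m n : nat,
        (N <= m)%N -> (N <= n)%N -> cnorm (u m - u n) < e) ->
    exists l : A, forall e : R, 0 < e -> exists N : nat, forall n : nat,
        (N <= n)%N -> cnorm (u n - l) < e;
  star : A -> A;
  starK : forall a : A, star (star a) = a;
  starD : forall a b : A, star (a + b) = star a + star b;
  starZ : forall (z : R[i]) (a : A), star (z *: a) = Num.conj z *: star a;
  starM : forall a b : A, star (a * b) = star b * star a;
  cnorm_starM : forall a : A, cnorm (star a * a) = cnorm a ^+ 2
}.

(* Unital C*-algebras over R[i]; they are nonzero since 1 != 0 in an algType. *)
#[short(type="cstarAlgType")]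
HB.structure Definition CStarAlgebra (R : realType) :=
  {A of Algebra_isCStarAlgebra R A & GRing.Algebra R[i] A}.

Definition strictly_convex (R : realType) (X : lmodType R[i]) (N : X -> R) :
    Prop :=
  forall x y : X, x != 0 -> y != 0 ->
    N (x + y) = N x + N y -> exists z : R[i], x = z *: y.

Definition invertible (E : pzRingType) (a : E) : Prop :=
  exists b : E, a * b = 1 /\ b * a = 1.

Section MatrixAlgebra.
Variables (R : realType) (A : cstarAlgType R) (n : nat).

Definition mxstar (a : 'M[A]_n) : 'M[A]_n := \matrix_(i, j) star (a j i).

(* (z%:A)%:M is z times the unit of M_n(A), which carries no canonical
   R[i]-algebra structure. *)
Definition mxspectrum (a : 'M[A]_n) (z : R[i]) : Prop :=
  ~ invertible (a - (z%:A)%:M).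

(* In R[i], 0 <= z means that z is real and nonnegative. *)
Definition mxpositive (a : 'M[A]_n) : Prop :=
  mxstar a = a /\ (forall z : R[i], mxspectrum a z -> 0 <= z).

End MatrixAlgebra.

(* v^* M v >= 0 for all v; this includes that v^* M v is real, so that M is
   Hermitian. *)
Definition psdmx (R : realType) (n : nat) (M : 'M[R[i]]_n) : Prop :=
  forall v : 'cV[R[i]]_n, 0 <= (map_mx Num.conj v^T *m M *m v) 0 0.

(* f is not assumed to be linear. *)
Definition npositive (R : realType) (A : cstarAlgType R) (n : nat)
    (f : A -> R[i]) : Prop :=
  forall a : 'M[A]_n, mxpositive a -> psdmx (map_mx f a).

(* Main.v *)
Require Import Defs.
From mathcomp Require Import all_boot all_order all_algebra.
From mathcomp Require Import complex reals.

Import Order.TTheory GRing.Theory Num.Theory.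
Local Open Scope ring_scope.
Local Open Scope complex_scope.

(** Strict convexity collapses the algebra because the triangle inequality
    becomes an equality between the square of a self-adjoint element and a
    suitable scalar.  The quantitative fact behind this is an arithmetic-geometric
    mean inequality [cnorm_amgm]: commuting self-adjoint [a] and [b] satisfy
    [2 ‖ab‖ <= ‖a² + b²‖].  It follows from the C*-identity for [w = a + ib],
    since [w* w = a² + b²], while [w² - w*²] equals [4i ab] and has norm at most
    [2 ‖w‖²].

    If [h] is self-adjoint and [c = ‖h‖], the inequality for [c 1] and [h] reads
    [‖c² 1 + h²‖ >= 2c² = ‖c² 1‖ + ‖h²‖].  By strict convexity [h²] is a scalar
    ([sqr_selfadjoint_scalar]).  The same holds for [(h + 1)²], so that
    [2h = (h + 1)² - h² - 1] is a scalar too.  Every element is [x + iy] with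
    [x] and [y] self-adjoint, hence is a scalar. *)

Section CStarNorm.
Variables (R : realType) (A : cstarAlgType R).
Implicit Types (a b h : A) (c : R).

Lemma normc_real c : Normc.normc c%:C = `|c|.
Proof. by rewrite /= expr0n /= addr0 sqrtr_sqr. Qed.

Lemma normc_i : Normc.normc ('i : R[i]) = 1.
Proof. by rewrite /= expr0n expr1n add0r sqrtr1. Qed.

Lemma cnorm_real c a : cnorm (c%:C *: a) = `|c| * cnorm a.
Proof. by rewrite cnormZ normc_real. Qed.

Lemma cnormN a : cnorm (- a) = cnorm a.
Proof.
have -> : - a = (-1)%:C *: a by rewrite rmorphN rmorph1 scaleN1r.
by rewrite cnorm_real normrN1 mul1r.
Qed.

Lemma cnorm_ge0 a : 0 <= cnorm a.
Proof.
have := ler_cnormD a (- a).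
have -> : a - a = 0%:C *: a by rewrite rmorph0 scale0r subrr.
by rewrite cnorm_real normr0 mul0r cnormN -mulr2n pmulrn_lge0.
Qed.

Lemma cnorm_gt0 a : a != 0 -> 0 < cnorm a.
Proof.
move=> a0; rewrite lt0r cnorm_ge0 andbT.
by apply: contra_neq a0; exact: cnorm0_eq0.
Qed.

Lemma star1 : star (1 : A) = 1.
Proof. by rewrite -[LHS]mulr1 -{2}(starK 1) -starM mulr1 starK. Qed.

Lemma cnorm1 : cnorm (1 : A) = 1.
Proof.
have n1 := cnorm_gt0 _ (oner_neq0 A).
have := cnorm_starM (1 : A); rewrite star1 mul1r expr2 => e.
by apply: (mulfI (lt0r_neq0 n1)); rewrite mulr1 -e.
Qed.

Lemma cnorm_scalar c : cnorm ((c%:C)%:A : A) = `|c|.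
Proof. by rewrite cnorm_real cnorm1 mulr1. Qed.

Lemma star_real c a : star (c%:C *: a) = c%:C *: star a.
Proof. by rewrite starZ; congr (_ *: _); exact: conjc_real. Qed.

Lemma star_i a : star ('i *: a) = - ('i *: star a).
Proof.
rewrite starZ -scaleNr; congr (_ *: _).
by apply/eqP; rewrite eq_complex /= oppr0 !eqxx.
Qed.

Lemma starN a : star (- a) = - star a.
Proof.
have E b : - b = (-1)%:C *: b by rewrite rmorphN rmorph1 scaleN1r.
by rewrite E star_real -E.
Qed.

(** The C*-identity gives [‖a‖² = ‖a* a‖ <= ‖a*‖ ‖a‖], and [‖a‖] cancels unless
    [a = 0].  Applied to [a*] as well, this makes the involution isometric. *)
Lemma ler_cnorm_star a : cnorm a <= cnorm (star a).
Proof.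
have [->|a0] := eqVneq a 0.
  have star0 : star (0 : A) = 0 by rewrite -{1}(subrr (0 : A)) starD starN subrr.
  by rewrite star0.
rewrite -(ler_pM2r (cnorm_gt0 _ a0)) -expr2 -cnorm_starM.
exact: ler_cnormM.
Qed.

Lemma cnorm_star a : cnorm (star a) = cnorm a.
Proof.
by apply: le_anti; rewrite ler_cnorm_star -{2}(starK a) ler_cnorm_star.
Qed.

Lemma cnorm_sqr_selfadjoint h : star h = h -> cnorm (h * h) = cnorm h ^+ 2.
Proof. by move=> hh; rewrite -{1}hh cnorm_starM. Qed.

Lemma sqrrD_comm a b : a * b = b * a ->
  (a + b) * (a + b) = a * a + b * b + a * b *+ 2.
Proof.
by move=> ab; rewrite mulrDl !mulrDr -ab [a * b + b * b]addrC addrACA mulr2n.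
Qed.

(** For [w = a + ib] one has [w* w = a² + b²] and [w² - w*² = 4i ab], so the
    claim compares the norm of [w² - w*²], at most [2 ‖w‖²], with
    [‖w* w‖ = ‖w‖²].  This replaces the order on positive elements, which would
    deduce it from [a² + b² >= ± 2ab]. *)
Lemma cnorm_amgm a b : star a = a -> star b = b -> a * b = b * a ->
  2 * cnorm (a * b) <= cnorm (a * a + b * b).
Proof.
move=> sa sb ab.
pose y := 'i *: b; pose w := a + y.
have ay : a * y = y * a by rewrite /y -scalerAr -scalerAl ab.
have yy : y * y = - (b * b).
  by rewrite /y -scalerAl -scalerAr scalerA -expr2 sqr_i scaleN1r.
have ws : star w = a - y by rewrite starD star_i sa sb.
have E1 : star w * w = a * a + b * b.
  by rewrite ws mulrDl !mulrDr !mulNr -ay yy opprK addrA addrK.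
have E2 : w * w - star w * star w = (4%:R)%:C *: ('i *: (a * b)).
  rewrite ws (sqrrD_comm _ _ ay) sqrrD_comm; last by rewrite mulrN mulNr ay.
  rewrite !mulrN mulNr opprK mulNrn opprD opprK addrACA subrr add0r -mulrnDr.
  by rewrite /y -scalerAr rmorph_nat scaler_nat.
have : cnorm (w * w - star w * star w) <= 2 * cnorm (star w * w).
  apply: (le_trans (ler_cnormD _ _)).
  rewrite cnormN cnorm_starM mulr_natl mulr2n lerD //.
    by rewrite expr2 ler_cnormM.
  by rewrite -(cnorm_star w) expr2 ler_cnormM.
rewrite E1 E2 cnorm_real cnormZ normc_i mul1r normr_nat.
have -> : 4%:R = 2 * 2 :> R by rewrite -natrM.
by rewrite -mulrA ler_pM2l // ltr0n.
Qed.

Definition is_scalar a : Prop := exists z : R[i], a = z%:A.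

Lemma is_scalarD a b : is_scalar a -> is_scalar b -> is_scalar (a + b).
Proof. by move=> [y ->] [z ->]; exists (y + z); rewrite scalerDl. Qed.

Lemma is_scalarZ (z : R[i]) a : is_scalar a -> is_scalar (z *: a).
Proof. by move=> [y ->]; exists (z * y); rewrite scalerA. Qed.

(** The scalar [c 1] with [c = ‖h‖] makes the arithmetic-geometric mean
    inequality meet the triangle inequality: the bound [2c ‖h‖] equals
    [c² + ‖h²‖].  Strict convexity then makes [h²] proportional to [c² 1]. *)
Lemma sqr_selfadjoint_scalar h :
  strictly_convex (fun a : A => cnorm a) -> star h = h -> is_scalar (h * h).
Proof.
move=> hconvex sh.
have [->|h0] := eqVneq h 0; first by exists 0; rewrite mulr0 scale0r.
set c := cnorm h; have c0 : 0 < c := cnorm_gt0 _ h0.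
pose u : A := (c%:C)%:A.
have su : star u = u by rewrite star_real star1.
have uh : u * h = c%:C *: h by rewrite -scalerAl mul1r.
have uu : u * u = ((c ^+ 2)%:C)%:A.
  by rewrite -scalerAl mul1r scalerA expr2 rmorphM.
have nhh : cnorm (h * h) = c ^+ 2 by exact: cnorm_sqr_selfadjoint.
have nuu : cnorm (u * u) = c ^+ 2.
  by rewrite uu cnorm_scalar ger0_norm // sqr_ge0.
have neq0 a : cnorm a = c ^+ 2 -> a != 0.
  apply: contra_eqN => /eqP ->.
  have -> : (0 : A) = (0%:C)%:A by rewrite rmorph0 scale0r.
  by rewrite cnorm_scalar normr0 eq_sym expf_neq0 // gt_eqF.
have [|z ez] := hconvex _ _ (neq0 _ nhh) (neq0 _ nuu).
  apply/eqP; rewrite eq_le ler_cnormD /= nhh nuu addrC.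
  have := cnorm_amgm u h su sh; rewrite uh -scalerAr mulr1 => /(_ erefl).
  rewrite cnorm_real (gtr0_norm c0) -/c -expr2 mulr_natl mulr2n.
  by rewrite [h * h + _]addrC.
by rewrite ez uu; apply: is_scalarZ; exists ((c ^+ 2)%:C).
Qed.

(** Translating by 1 keeps an element self-adjoint, so polarization recovers [h]
    from the squares of [h + 1] and [h]. *)
Lemma selfadjoint_scalar h :
  strictly_convex (fun a : A => cnorm a) -> star h = h -> is_scalar h.
Proof.
move=> hconvex sh.
have E : h = (2%:R)^-1 *: ((h + 1) * (h + 1) + (-1) *: (h * h) + (-1) *: 1).
  rewrite sqrrD_comm ?mulr1 ?mul1r // !scaleN1r -[_ + 1 + _]addrA.
  rewrite [1 + _]addrC addrA [_ - h * h]addrC !addrA addNr add0r addrK.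
  by rewrite -mulr2n -[h *+ 2]scaler_nat scalerA mulVf ?scale1r // pnatr_eq0.
rewrite E; apply: is_scalarZ; apply: is_scalarD; last by exists (-1).
apply: is_scalarD; last by apply: is_scalarZ; exact: sqr_selfadjoint_scalar.
by apply: sqr_selfadjoint_scalar => //; rewrite starD star1 sh.
Qed.

End CStarNorm.

Theorem corollary3p6 (R : realType) (A : cstarAlgType R)
    (hconvex : strictly_convex (fun a : A => cnorm a))
    (hpos : npositive 3 (fun a : A => (cnorm a)%:C)) :
  forall a : A, exists z : R[i], a = z%:A.
Proof.
move=> a.
have two : (2%:R : R[i]) != 0 by rewrite pnatr_eq0.
(* Cartesian decomposition: the factor 'i turns the skew-adjoint part
   a - star a into a self-adjoint element. *)
have E : a = (2%:R)^-1 *: ((a + star a) + (-'i) *: ('i *: (a - star a))).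
  rewrite scalerA mulNr -expr2 sqr_i opprK scale1r addrACA subrr addr0.
  by rewrite -mulr2n -[a *+ 2]scaler_nat scalerA mulVf // scale1r.
rewrite E; apply: is_scalarZ; apply: is_scalarD; last apply: is_scalarZ.
  by apply: selfadjoint_scalar => //; rewrite starD starK addrC.
apply: selfadjoint_scalar => //.
by rewrite star_i starD starN starK -scalerN opprB.
Qed.
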